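(* $\pi_{5.3}(\emptyset)=\pi_{5.7}(\emptyset)=\dfrac{20}{27}$.
   Context: A $3$-graph is a pair $G=(V,E)$ with $E$ a set of $3$-element subsets of $V$. For integers $m,k$, $m.k$ denotes the family of all $3$-graphs on $m$ vertices with exactly $k$ edges. For a $3$-graph $G$ on $n\ge m$ vertices, $e_{m.k}(G)$ is the number of $m$-element subsets of $V(G)$ spanning exactly $k$ edges of $G$, and $\pi_{m.k}(\emptyset)=\lim_{n\to\infty}\max\{e_{m.k}(G): |V(G)|=n\}/\binom{n}{m}$ (the limit exists). *)

(* Defs.v *)
From HB Require Import structures.
From mathcomp Require Import all_boot all_order all_algebra.
From mathcomp Require Import all_classical all_reals.
From mathcomp Require Import topology normedtype sequences.

Set Implicit Arguments.
Unset Strict Implicit.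
Unset Printing Implicit Defensive.

Import Order.TTheory GRing.Theory Num.Theory.
Import numFieldNormedType.Exports.

Local Open Scope ring_scope.

(* A 3-graph on the finite vertex type V is given by its edge set. *)
Definition is_3graph (V : finType) (E : {set {set V}}) : bool :=
  [forall e in E, #|e| == 3%N].

Definition spanned_edges (V : finType) (E : {set {set V}}) (S : {set V}) :
    {set {set V}} :=
  [set e in E | e \subset S].

Definition e_mk (m k : nat) (V : finType) (E : {set {set V}}) : nat :=
  #|[set S : {set V} | (#|S| == m) && (#|spanned_edges E S| == k)]|.

(* Every 3-graph with n vertices is isomorphic to one on 'I_n and e_mk is
   isomorphism invariant, so the maximum may be taken over edge sets on 'I_n. *)
Definition max_e_mk (m k n : nat) : nat :=
  \max_(E : {set {set 'I_n}} | is_3graph E) e_mk m k E.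

(* For n < m the denominator vanishes and the ratio is 0 by convention; this
   does not affect the limit. *)
Definition ratio_mk (R : realType) (m k : nat) : R^nat :=
  fun n => (max_e_mk m k n)%:R / ('C(n, m))%:R.

Definition pi_mk (R : realType) (m k : nat) : R := limn (ratio_mk R m k).

(* Main.v *)
Require Import Defs.
From Stdlib Require Import ZArith.
From mathcomp Require Import all_boot all_order all_algebra.
From mathcomp Require Import all_classical all_reals.
From mathcomp Require Import topology normedtype sequences realfun.
From mathcomp Require Import ssrZ zify ring lra.

Set Implicit Arguments.
Unset Strict Implicit.
Unset Printing Implicit Defensive.

Import Order.TTheory GRing.Theory Num.Theory.
Import numFieldNormedType.Exports.

(* The delimiters Z and N are taken by int and nat. *)
Delimit Scope Z_scope with BZ.
Local Open Scope ring_scope.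

(** Complementation exchanges 5.3 and 5.7, so only 5.3 matters.

    Lower bound: colour the vertices by their residues mod 3 and take as edges
    the triples whose sum is 1 mod 3, i.e. those of colours 001, 112, 220.
    Of the 243 colour patterns of five vertices, 180 span three edges.

    Upper bound: a flag algebra argument.  For four roots and a function u of
    the link of a vertex in the roots, the square of the sum over d of
    u(link of d) is nonnegative; a positive combination of such squares, summed
    over all roots, is a sum over 6-tuples of vertices.  Adding to it a multiple
    of (density of 5.3) - 20/27 and averaging over the choices of four roots
    among six vertices gives a function of the 3-graph induced by the 6-tuple
    which is nowhere positive.  Sums run over all maps from the six indices
    to the vertices, so there are no error terms.

    The last fact is checked by computation, on the six-vertex graphs whose
    last five vertices are listed in an order minimizing the binary code of
    the graph they induce. *)

(** * Lexicographic subsequences and induced patterns *)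

Fixpoint ksubseqs (T : Type) (k : nat) (s : seq T) : seq (seq T) :=
  match k, s with
  | 0, _ => [:: [::]]
  | k'.+1, x :: s' => [seq x :: t | t <- ksubseqs k' s'] ++ ksubseqs k s'
  | _, [::] => [::]
  end.

Lemma map_ksubseqs (T U : Type) (f : T -> U) (k : nat) (s : seq T) :
  ksubseqs k (map f s) = [seq map f t | t <- ksubseqs k s].
Proof.
elim: s k => [|x s IHs] [|k] //=.
by rewrite map_cat -map_comp !IHs -map_comp.
Qed.

Lemma size_ksubseqs (T : Type) (k : nat) (s : seq T) :
  size (ksubseqs k s) = 'C(size s, k).
Proof.
elim: s k => [|x s IHs] [|k] //=.
by rewrite size_cat size_map !IHs binS addnC.
Qed.

Lemma mem_ksubseqs (T : eqType) (k : nat) (s t : seq T) :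
  (t \in ksubseqs k s) = (size t == k) && subseq t s.
Proof.
elim: s k t => [|x s IHs] [|k] [|y t] //=; first by rewrite andbF.
  by rewrite mem_cat IHs orbF; apply/mapP => -[].
rewrite mem_cat IHs eqSS; case: (eqVneq y x) => [->|neq_yx].
  rewrite mem_map ?IHs => [|? ? [] //]; case: (size t == k) => //=.
  by apply/orb_idr/subseq_trans/subseq_cons.
by case: mapP => // -[u _ [eq_yx _]]; rewrite eq_yx eqxx in neq_yx.
Qed.

Lemma ksubseqs_uniq (T : eqType) (k : nat) (s : seq T) :
  uniq s -> uniq (ksubseqs k s).
Proof.
elim: s k => [|x s IHs] [|k] //= /andP[x_notin_s s_uniq].
rewrite cat_uniq map_inj_uniq => [|? ? [] //]; rewrite !IHs // andbT /=.
apply/hasPn => t; rewrite mem_ksubseqs => /andP[_ /mem_subseq t_sub_s].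
by apply/mapP => -[u _ tE]; rewrite t_sub_s ?tE ?mem_head in x_notin_s.
Qed.

Lemma perm_ksubseqs_sets (T : finType) (k : nat) (s : seq T) : uniq s ->
  perm_eq [seq [set x in t] | t <- ksubseqs k s]
    (enum [set A : {set T} | (A \subset [set x in s]) && (#|A| == k)]).
Proof.
move=> s_uniq; apply: uniq_perm (enum_uniq _) _ => [|A].
  rewrite map_inj_in_uniq ?ksubseqs_uniq // => t u.
  rewrite !mem_ksubseqs => /andP[_ t_sub] /andP[_ u_sub] /setP eq_tu.
  rewrite (subseq_uniqP s_uniq t_sub) (subseq_uniqP s_uniq u_sub).
  by apply: eq_filter => x; have := eq_tu x; rewrite !inE.
rewrite mem_enum inE; apply/mapP/andP => [[t]|[A_sub_s /eqP <-]].
  rewrite mem_ksubseqs => /andP[/eqP <- t_sub] ->.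
  rewrite cardsE (card_uniqP (subseq_uniq t_sub s_uniq)); split=> //.
  by apply/fintype.subsetP => x; rewrite !inE; apply: mem_subseq.
exists [seq x <- s | x \in A]; last first.
  apply/setP => x; rewrite inE mem_filter andb_idr // => xA.
  by have := fintype.subsetP A_sub_s x xA; rewrite inE.
rewrite mem_ksubseqs filter_subseq andbT -(card_uniqP _) ?filter_uniq //.
apply/eqP/eq_card => x; rewrite mem_filter andb_idr // => xA.
by have := fintype.subsetP A_sub_s x xA; rewrite inE.
Qed.

Definition pattern (V T : Type) (k : nat) (e : seq V -> T) (s : seq V) :
    seq T :=
  [seq e t | t <- ksubseqs k s].

Definition link (V T : Type) (e : seq V -> T) (d : V) (s : seq V) : seq T :=
  pattern 2 (fun t => e (d :: t)) s.

Lemma pattern_map (U V T : Type) (f : U -> V) (k : nat) (e : seq V -> T)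
    (s : seq U) :
  pattern k e (map f s) = pattern k (fun t => e (map f t)) s.
Proof. by rewrite /pattern map_ksubseqs -map_comp. Qed.

Lemma pattern_comp (V T U : Type) (f : T -> U) (k : nat) (e : seq V -> T)
    (s : seq V) :
  pattern k (fun t => f (e t)) s = map f (pattern k e s).
Proof. by rewrite /pattern -map_comp. Qed.

Lemma size_pattern (V T : Type) (k : nat) (e : seq V -> T) (s : seq V) :
  size (pattern k e s) = 'C(size s, k).
Proof. by rewrite size_map size_ksubseqs. Qed.

Definition edge_count (V : Type) (e : seq V -> bool) (s : seq V) : nat :=
  count id (pattern 3 e s).

Lemma pattern3_cons (V T : Type) (e : seq V -> T) (d : V) (s : seq V) :
  pattern 3 e (d :: s) = link e d s ++ pattern 3 e s.
Proof. by rewrite /pattern /= map_cat -map_comp. Qed.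

Lemma eq_in_pattern (V : eqType) (T : Type) (k : nat) (e g : seq V -> T)
    (s : seq V) :
  (forall t, size t = k -> subseq t s -> e t = g t) ->
  pattern k e s = pattern k g s.
Proof.
move=> eg; apply/eq_in_map => t; rewrite mem_ksubseqs => /andP[/eqP].
exact: eg.
Qed.

Definition perm_invariant (V : eqType) (T : Type) (e : seq V -> T) : Prop :=
  forall s t, perm_eq s t -> e s = e t.

Lemma perm_invariant_cons (V : eqType) (T : Type) (e : seq V -> T) (d : V) :
  perm_invariant e -> perm_invariant (fun t => e (d :: t)).
Proof. by move=> e_perm s t st; apply: e_perm; rewrite perm_cons. Qed.

(* The position of the k-subset t of {0, .., n - 1} in ksubseqs k (iota 0 n),
   whatever the order in which t is listed. *)
Definition ksubseq_index (k n : nat) (t : seq nat) : nat :=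
  index [seq i <- iota 0 n | i \in t] (ksubseqs k (iota 0 n)).

Definition subpattern (k n : nat) (p : seq nat) : seq bool -> seq bool :=
  let q := pattern k (ksubseq_index k n) p in
  fun s => [seq nth false s i | i <- q].

Lemma size_subpattern (k n : nat) (p : seq nat) (s : seq bool) :
  size (subpattern k n p s) = 'C(size p, k).
Proof. by rewrite size_map size_pattern. Qed.

Section Subpatterns.

Variables (V : eqType) (e : seq V -> bool) (x0 : V) (k : nat) (s : seq V).
Hypothesis e_perm : perm_invariant e.

Lemma nth_pattern (t : seq nat) :
  uniq t -> {subset t <= iota 0 (size s)} -> size t = k ->
  nth false (pattern k e s) (ksubseq_index k (size s) t) =
    e [seq nth x0 s i | i <- t].
Proof.
move=> t_uniq t_sub t_k; set u := [seq i <- iota 0 (size s) | i \in t].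
have tu : perm_eq u t.
  apply: uniq_perm => [||i]; rewrite ?filter_uniq ?iota_uniq //.
  by rewrite mem_filter andb_idr // => /t_sub.
have u_in : u \in ksubseqs k (iota 0 (size s)).
  by rewrite mem_ksubseqs filter_subseq (perm_size tu) t_k eqxx.
have -> : pattern k e s =
    pattern k (fun v => e [seq nth x0 s i | i <- v]) (iota 0 (size s)).
  by rewrite -pattern_map map_nth_iota0 // take_size.
rewrite (nth_map [::]) ?index_mem // nth_index //.
exact/e_perm/perm_map.
Qed.

Lemma pattern_subpattern (p : seq nat) :
  uniq p -> {subset p <= iota 0 (size s)} ->
  pattern k e [seq nth x0 s i | i <- p] =
    subpattern k (size s) p (pattern k e s).
Proof.
move=> p_uniq p_sub; rewrite pattern_map /subpattern -pattern_comp.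
apply: eq_in_pattern => t t_k t_p.
rewrite nth_pattern ?(subseq_uniq t_p) // => i /(mem_subseq t_p).
exact: p_sub.
Qed.

End Subpatterns.

(** * Words and binary trees *)

Fixpoint words (T : Type) (n : nat) (s : seq T) : seq (seq T) :=
  if n is m.+1 then [seq x :: w | x <- s, w <- words m s] else [:: [::]].

Lemma mem_words (T : eqType) (n : nat) (s w : seq T) :
  (w \in words n s) = (size w == n) && all [in s] w.
Proof.
elim: n w => [|n IHn] [|x w] //=; first by apply/allpairsP => -[? []].
rewrite eqSS; apply/allpairsP/and3P => [[[y v] /= [ys + [-> ->]]]|[]].
  by rewrite IHn => /andP[].
by move=> w_n xs ws; exists (x, w); rewrite IHn w_n ws.
Qed.

Definition bits (n : nat) : seq (seq bool) := words n [:: false; true].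

Lemma mem_bits (n : nat) (w : seq bool) : (w \in bits n) = (size w == n).
Proof. by rewrite mem_words; apply/andb_idr => _; apply/allP => -[]. Qed.

Inductive btree (A : Type) := Leaf of A | Node of btree A & btree A.

Fixpoint btree_get (A : Type) (t : btree A) (s : seq bool) : A :=
  match t, s with
  | Leaf a, _ => a
  | Node l r, b :: s' => btree_get (if b then r else l) s'
  | Node l _, [::] => btree_get l [::]
  end.

Fixpoint tabulate (A : Type) (n : nat) (f : seq bool -> A) : btree A :=
  if n is m.+1 then
    Node (tabulate m (fun s => f (false :: s)))
         (tabulate m (fun s => f (true :: s)))
  else Leaf (f [::]).

Lemma btree_get_tabulate (A : Type) (n : nat) (f : seq bool -> A)
    (s : seq bool) :
  size s = n -> btree_get (tabulate n f) s = f s.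
Proof. by elim: n f s => [|n IHn] f [|[] s] //= [/IHn->]. Qed.

(** * Sums over pairs of entries and over tuples *)

Lemma perm_rem (T : eqType) (x : T) (s t : seq T) :
  perm_eq s t -> perm_eq (rem x s) (rem x t).
Proof.
by move=> st; apply/permP => a; rewrite !count_rem (perm_mem st) (permP st).
Qed.

Lemma remC (T : eqType) (x y : T) (s : seq T) :
  rem x (rem y s) = rem y (rem x s).
Proof.
elim: s => //= z s IHs; have [->|/negPf zy] := eqVneq z y.
  by have [->|yx] := eqVneq y x; rewrite //= eqxx.
have [->|/negPf zx] := eqVneq z x; first by rewrite /= eqxx.
by rewrite /= zx zy IHs.
Qed.

Lemma perm_to_rem2 (T : eqType) (x y : T) (s : seq T) :
  x \in s -> y \in rem x s -> perm_eq s [:: x, y & rem y (rem x s)].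
Proof.
move=> xs ys; apply: perm_trans (perm_to_rem xs) _.
by rewrite perm_cons perm_to_rem.
Qed.

Lemma perm_map_rem (T U : eqType) (f : T -> U) (x : T) (s : seq T) :
  x \in s -> perm_eq (rem (f x) (map f s)) (map f (rem x s)).
Proof.
move=> xs; rewrite -(perm_cons (f x)) perm_sym.
apply: perm_trans (perm_to_rem (map_f f xs)).
by rewrite -map_cons perm_map // perm_sym perm_to_rem.
Qed.

Lemma sum_rem_ksubseqs (T : eqType) (R : nmodType) (G : T -> T -> R)
    (x0 : T) (s : seq T) :
  (forall x y, G x y = G y x) ->
  \sum_(x <- s) \sum_(y <- rem x s) G x y =
    (\sum_(t <- ksubseqs 2 s) G (nth x0 t 0) (nth x0 t 1)) *+ 2.
Proof.
move=> GC; elim: s => [|x s IHs]; first by rewrite !big_nil mul0rn.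
rewrite big_cons /= eqxx.
have -> : \sum_(y <- s) \sum_(z <- rem y (x :: s)) G y z =
    \sum_(y <- s) (G x y + \sum_(z <- rem y s) G y z).
  apply: eq_big_seq => y ys; rewrite (GC x) -[RHS](big_cons _ _ x _ predT).
  by apply: perm_big => /=; case: (eqVneq x y) => [->|//]; apply: perm_to_rem.
rewrite big_split {}IHs big_cat big_map /= mulrnDl addrA -mulr2n.
have -> : ksubseqs 1 s = [seq [:: y] | y <- s].
  by elim: s => //= y s ->; case: s.
by rewrite big_map.
Qed.

Definition pair_sum (V : eqType) (R : nmodType) (w : V -> V -> seq V -> R)
    (s : seq V) : R :=
  \sum_(d <- s) \sum_(f <- rem d s) w d f (rem f (rem d s)).

Section PairSums.

Variables (V : eqType) (R : nmodType) (m : nat) (w : V -> V -> seq V -> R).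
Hypothesis w_perm : forall d f s t, size s = m -> perm_eq s t ->
  w d f s = w d f t.

Lemma pair_sum_perm (s t : seq V) : size s = m.+2 -> perm_eq s t ->
  pair_sum w s = pair_sum w t.
Proof.
move=> s_m st; rewrite /pair_sum (perm_big _ st).
apply: eq_big_seq => d dt; have ds : d \in s by rewrite (perm_mem st).
rewrite (perm_big _ (perm_rem d st)); apply: eq_big_seq => f ft.
apply: w_perm; last by do 2![apply: perm_rem].
by rewrite size_rem ?size_rem ?s_m ?(perm_mem (perm_rem d st)).
Qed.

Lemma pair_sum_map (I : eqType) (h : I -> V) (s : seq I) : size s = m.+2 ->
  pair_sum w (map h s) =
    pair_sum (fun i j r => w (h i) (h j) (map h r)) s.
Proof.
move=> s_m; rewrite /pair_sum big_map; apply: eq_big_seq => i si.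
have hi := perm_map_rem h si; rewrite (perm_big _ hi) big_map.
apply: eq_big_seq => j sj; have hj := perm_map_rem h sj.
apply: w_perm; last exact: perm_trans (perm_rem _ hi) hj.
by rewrite (perm_size (perm_trans (perm_rem _ hi) hj)) size_map !size_rem ?s_m.
Qed.

End PairSums.

Lemma big_tupleS (R : Type) (idx : R) (op : Monoid.com_law idx) (V : finType)
    (n : nat) (F : seq V -> R) :
  \big[op/idx]_(x : n.+1.-tuple V) F x =
    \big[op/idx]_d \big[op/idx]_(x : n.-tuple V) F (d :: x).
Proof.
rewrite pair_bigA.
rewrite (reindex (fun p : V * n.-tuple V => [tuple of p.1 :: p.2])) //.
exists (fun t => (thead t, [tuple of behead t])) => [[x t] _ | t _] /=.
  by congr (_, _); apply: val_inj.
by rewrite [RHS]tuple_eta.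
Qed.

Lemma big_tuple0 (R : Type) (idx : R) (op : Monoid.law idx) (V : finType)
    (F : seq V -> R) :
  \big[op/idx]_(x : 0.-tuple V) F x = F [::].
Proof. by rewrite (big_pred1 [tuple]) // => t; apply/esym/eqP/tuple0. Qed.

Lemma big_tuple_perm (R : Type) (idx : R) (op : Monoid.com_law idx)
    (V : finType) (n : nat) (F : seq V -> R) (p : seq 'I_n) :
  perm_eq p (enum 'I_n) ->
  \big[op/idx]_(x : n.-tuple V) F [seq tnth x i | i <- p] =
    \big[op/idx]_(x : n.-tuple V) F x.
Proof.
move=> p_enum; have size_p : size p == n.
  by rewrite (perm_size p_enum) size_enum_ord.
pose h (x : n.-tuple V) := [tuple of map (tnth x) (Tuple size_p)].
rewrite [RHS](reindex_inj (h := h)) //.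
move=> x y /(congr1 val)/eq_in_map eq_xy; apply: eq_from_tnth => i.
by apply: eq_xy; rewrite (perm_mem p_enum) mem_enum.
Qed.

Lemma sum_tuple_pair_sum (V : finType) (R : nmodType) (m : nat)
    (w : V -> V -> seq V -> R) :
  (forall d f s t, size s = m -> perm_eq s t -> w d f s = w d f t) ->
  \sum_(x : m.+2.-tuple V) pair_sum w x =
    (\sum_(r : m.-tuple V) \sum_d \sum_f w d f r) *+ (m.+2 * m.+1).
Proof.
move=> w_perm; pose F (x : seq V) := if x is [:: d, f & r] then w d f r else 0.
have FE : \sum_(x : m.+2.-tuple V) F x =
    \sum_(r : m.-tuple V) \sum_d \sum_f w d f r.
  rewrite big_tupleS [RHS]exchange_big; apply: eq_bigr => d _.
  by rewrite (big_tupleS _ _ (fun x => F (d :: x))) [RHS]exchange_big.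
pose s := enum 'I_m.+2; have s_m : size s = m.+2 by rewrite size_enum_ord.
under eq_bigr => x _ do rewrite -(map_tnth_enum x) (pair_sum_map w_perm) //.
rewrite exchange_big /=.
have pair_const i j : i \in s -> j \in rem i s ->
    \sum_(x : m.+2.-tuple V) w (tnth x i) (tnth x j)
      [seq tnth x l | l <- rem j (rem i s)] = \sum_(x : m.+2.-tuple V) F x.
  move=> si sj; pose p := [:: i, j & rem j (rem i s)].
  by rewrite -(big_tuple_perm _ F (p := p)) // perm_sym perm_to_rem2.
have sum_const (c : R) (u : seq 'I_m.+2) : \sum_(i <- u) c = c *+ size u.
  by rewrite big_const_seq count_predT iter_addr_0.
rewrite -FE mulnC mulrnA -[X in _ *+ X]s_m -sum_const.
apply: eq_big_seq => i si; rewrite exchange_big.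
rewrite -[X in _ *+ X]/(m.+2.-1) -[X in _ *+ X.-1]s_m -(size_rem si) -sum_const.
by apply: eq_big_seq => j; apply: pair_const.
Qed.

(** * The flag algebra certificate *)

(* The values of the functionals are listed in the order of bits 6.  The
   functionals come from a rounded solution of the semidefinite program of the
   flag algebra method.  They are orthogonal to the distribution of links in
   the extremal colouring, and those which are not invariant under the
   symmetries of the type occur with a full orthogonal basis of the irreducible
   representation they generate. *)
Definition cert_no_edge : seq (Z * seq Z) :=
  [::
   (3105,
    [:: -80; -72; -72; -66; -72; -66; -66; 85; -72; -66; -66; -5; 115; 32; 32;
     0; -72; -66; 115; 32; -66; -5; 32; 0; -66; 85; 32; 0; 32; 0; -61; 37; -72;
     115; -66; 32; -66; 32; -5; 0; -66; 32; 85; 0; 32; -61; 0; 37; -66; 32; 32;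
     -61; 85; 0; 0; 37; -5; 0; 0; 37; 0; 37; 37; 160]);
   (145935,
    [:: 0; -8; -8; -2; -8; -2; -2; 5; -8; -2; -2; -5; 19; 0; 0; 0; -8; -2; 19;
     0; -2; -5; 0; 0; -2; 5; 0; 0; 0; 0; -13; 5; -8; 19; -2; 0; -2; 0; -5; 0;
     -2; 0; 5; 0; 0; -13; 0; 5; -2; 0; 0; -13; 5; 0; 0; 5; -5; 0; 0; 5; 0; 5;
     5; 0]);
   (26827200,
    [:: 0; 0; 0; 0; 0; 0; 0; 0; 0; 0; 0; 0; 0; -1; 0; 0; 0; 0; 0; 1; 0; 0; 0;
     0; 0; 0; 0; 0; 0; 0; 0; 0; 0; 0; 0; 0; 0; 0; 0; 0; 0; 0; 0; 0; 1; 0; 0; 0;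
     0; 0; -1; 0; 0; 0; 0; 0; 0; 0; 0; 0; 0; 0; 0; 0]);
   (26827200,
    [:: 0; 0; 0; 0; 0; 0; 0; 0; 0; 0; 0; 0; 0; 0; 0; 0; 0; 0; 0; 0; 0; 0; -1;
     0; 0; 0; 1; 0; 0; 0; 0; 0; 0; 0; 0; 0; 0; 1; 0; 0; 0; -1; 0; 0; 0; 0; 0;
     0; 0; 0; 0; 0; 0; 0; 0; 0; 0; 0; 0; 0; 0; 0; 0; 0]);
   (26827200,
    [:: 0; 0; 0; 0; 0; 0; 0; 0; 0; 0; 0; 0; 0; 0; 1; 0; 0; 0; 0; 0; 0; 0; 0; 0;
     0; 0; 0; 0; -1; 0; 0; 0; 0; 0; 0; -1; 0; 0; 0; 0; 0; 0; 0; 0; 0; 0; 0; 0;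
     0; 1; 0; 0; 0; 0; 0; 0; 0; 0; 0; 0; 0; 0; 0; 0])]%BZ.

Definition cert_one_edge : seq (Z * seq Z) :=
  [::
   (7728,
    [:: -1; 5; 5; -25; -18; 5; 5; 10; 5; -25; -25; 44; 45; 0; 0; 4; -18; 5; 45;
     0; -20; 0; -40; 0; 5; 10; 0; 4; -40; 0; -18; 0; -18; 45; 5; 0; -20; -40;
     0; 0; 5; 0; 10; 4; -40; -18; 0; 0; -20; -40; -40; -18; -58; -5; -5; -5; 0;
     0; 0; 0; -5; -5; -5; 0]);
   (1159200,
    [:: 2; -1; -1; 5; 0; -1; -1; -2; -1; 5; 5; 2; 0; 0; 0; 1; 0; -1; 0; 0; -5;
     0; -1; 0; -1; -2; 0; 1; -1; 0; 0; 0; 0; 0; -1; 0; -5; -1; 0; 0; -1; 0; -2;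
     1; -1; 0; 0; 0; -5; -1; -1; 0; -1; 1; 1; 1; 0; 0; 0; 0; 1; 1; 1; 0]);
   (15090300,
    [:: 0; 0; 0; 0; 0; 0; 1; 0; 0; 0; 0; 0; 0; 0; 0; 0; 0; 0; 0; 0; 0; 0; 0; 0;
     1; 0; 0; 0; 0; 0; 0; 0; 0; 0; -1; 0; 0; 0; 0; 0; -1; 0; 0; 0; 0; 0; 0; 0;
     0; 0; 0; 0; 0; 0; 0; 0; 0; 0; 0; 0; 0; 0; 0; 0]);
   (5030100,
    [:: 0; 0; 0; 0; 0; 2; 1; 0; 0; 0; 0; 0; 0; 0; 0; 0; 0; -2; 0; 0; 0; 0; 0;
     0; -1; 0; 0; 0; 0; 0; 0; 0; 0; 0; -1; 0; 0; 0; 0; 0; 1; 0; 0; 0; 0; 0; 0;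
     0; 0; 0; 0; 0; 0; 0; 0; 0; 0; 0; 0; 0; 0; 0; 0; 0]);
   (162288,
    [:: 0; 0; 0; 0; 1; -1; -2; 0; 0; 0; 0; 0; -5; 0; 0; -1; 1; -1; -5; 0; -10;
     0; -4; 0; -2; 0; 0; -1; -4; 0; -10; 0; -2; 10; 3; 0; 5; 1; 0; 0; 3; 0; 0;
     2; 3; 5; 0; 0; 5; 1; 3; 5; 0; 0; 0; -1; 0; 0; 0; 0; 0; -1; 2; 0]);
   (54096,
    [:: 0; 0; 0; 0; 3; -5; -4; 0; 0; 0; 0; 0; -15; 0; 0; -3; -3; 5; 15; 0; 0;
     0; -2; 0; 4; 0; 0; 3; 2; 0; 0; 0; 0; 0; 1; 0; -15; -7; 0; 0; -1; 0; 0; 0;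
     -5; -15; 0; 0; 15; 7; 5; 15; 0; 0; 0; -3; 0; 0; 0; 0; 0; 3; 0; 0]);
   (287040,
    [:: 0; 4; -2; 5; 1; 8; -2; -3; -2; 5; -10; 0; 0; 0; 0; 1; 1; 8; 0; 0; 10;
     0; -1; 0; -2; -3; 0; 1; -1; 0; 0; 0; -2; 0; -6; 0; -5; -1; 0; 0; -6; 0; 6;
     -2; 2; 0; 0; 0; -5; -1; 2; 0; 0; 2; -1; 1; 0; 0; 0; 0; -1; 1; -2; 0]);
   (95680,
    [:: 0; 0; 6; 15; 3; 4; 14; -9; -6; -15; 0; 0; 0; 0; 0; 3; -3; -4; 0; 0; 0;
     0; -3; 0; -14; 9; 0; -3; 3; 0; 0; 0; 0; 0; 10; 0; 15; -3; 0; 0; -10; 0; 0;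
     0; 0; 0; 0; 0; -15; 3; 0; 0; 0; 0; 3; 3; 0; 0; 0; 0; -3; -3; 0; 0])]%BZ.

Definition cert_three_edges : seq (Z * seq Z) :=
  [::
   (13500,
    [:: -90; 9; 9; 0; 9; 0; 0; 46; 0; 0; 0; 0; 9; 18; 18; 9; 0; 0; 9; 18; 0; 0;
     18; 9; 27; 9; 0; 9; 0; 9; 18; 27; 0; 9; 0; 18; 0; 18; 0; 9; 27; 0; 9; 9;
     0; 18; 9; 27; 27; 0; 0; 18; 9; 9; 9; 27; 44; 27; 27; 0; 27; 0; 0; 18]);
   (235440,
    [:: -10; 1; 1; 0; 1; 0; 0; 0; 0; 0; 0; 0; 1; 2; 2; 1; 0; 0; 1; 2; 0; 0; 2;
     1; 3; 1; 0; 1; 0; 1; 2; 3; 0; 1; 0; 2; 0; 2; 0; 1; 3; 0; 1; 1; 0; 2; 1; 3;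
     3; 0; 0; 2; 1; 1; 1; 3; 10; 3; 3; 0; 3; 0; 0; 2])]%BZ.

(* The certificates are given for the types 0000, 1000 and 1110; the roots of
   other types are relabelled.  The triple in position i of a type is the
   complement of the root 3 - i. *)
Definition certificate (t : seq bool) : seq (Z * seq Z) * seq nat :=
  match count id t with
  | 0 => (cert_no_edge, iota 0 4)
  | 1 => let i := (3 - index true t)%N in
         (cert_one_edge, rcons (rem i (iota 0 4)) i)
  | 3 => let i := (3 - index false t)%N in
         (cert_three_edges, i :: rem i (iota 0 4))
  | _ => ([::], iota 0 4)
  end.

Definition functional (v : seq Z) : seq bool -> Z :=
  btree_get (tabulate 6 (fun a => nth 0%BZ v (index a (bits 6)))).

Definition square_terms (t : seq bool) : seq (Z * (seq bool -> Z)) :=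
  let: (c, p) := certificate t in
  let r := subpattern 2 4 p in
  [seq (q.1, let u := functional q.2 in fun a => u (r a)) | q <- c].

Definition diag_form (c : seq (Z * (seq bool -> Z))) (a b : seq bool) : Z :=
  foldr (fun q z => q.1 * (q.2 a * q.2 b) + z)%BZ 0%BZ c.

Definition three_edges (s : seq bool) : Z :=
  if count id s == 3%N then 1%BZ else 0%BZ.

(* The density enters through its excess over 20/27; the factor 496800 is
   8/9 of 558900, the common denominator of the weights of the certificates. *)
Definition flag_weight (t : seq bool) : seq bool -> seq bool -> Z :=
  let c := square_terms t in fun a b =>
  (diag_form c a b +
   496800 * (27 * (three_edges (a ++ t) + three_edges (b ++ t)) - 40))%BZ.

Lemma diag_formC (c : seq (Z * (seq bool -> Z))) (a b : seq bool) :
  diag_form c a b = diag_form c b a.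
Proof. by elim: c => //= q c ->; congr (_ * _ + _)%BZ; apply: Z.mul_comm. Qed.

Lemma flag_weightC (t a b : seq bool) : flag_weight t a b = flag_weight t b a.
Proof.
rewrite /flag_weight diag_formC; congr (_ + _ * (_ * _ - _))%BZ.
exact: Z.add_comm.
Qed.

Lemma diag_form_sum_ge0 (I : finType) (g : I -> seq bool)
    (c : seq (Z * (seq bool -> Z))) :
  all (fun q => Z.leb 0 q.1) c ->
  0 <= \sum_i \sum_j diag_form c (g i) (g j) :> Z.
Proof.
elim: c => [|q c IHc] /=.
  by move=> _; rewrite big1 // => i _; rewrite big1.
case/andP=> q_ge0 /IHc {}IHc.
have -> : \sum_i \sum_j (q.1 * (q.2 (g i) * q.2 (g j)) +
      diag_form c (g i) (g j))%BZ =
    q.1 * (\sum_i q.2 (g i)) ^+ 2 + \sum_i \sum_j diag_form c (g i) (g j) :> Z.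
  rewrite expr2 mulr_suml mulr_sumr -big_split; apply: eq_bigr => i _.
  by rewrite /= !mulr_sumr -big_split.
rewrite addr_ge0 // mulr_ge0 ?sqr_ge0 //; lia.
Qed.

Lemma square_terms_ge0 (t : seq bool) :
  all (fun q => Z.leb 0 q.1) (square_terms t).
Proof. by rewrite /square_terms /certificate; case: count => [|[|[|[|n]]]]. Qed.

Definition table := btree (btree (btree Z)).

(* Partial results are bound by let, and tables and lists of positions are
   arguments of the checks below, so that they are evaluated only once. *)
Definition lookup (w : table) (t : seq bool) : seq bool -> seq bool -> Z :=
  let wt := btree_get w t in
  fun a => let wta := btree_get wt a in btree_get wta.

Definition weight_table : table :=
  tabulate 4 (fun t =>
    let w := flag_weight t in tabulate 6 (fun a => tabulate 6 (w a))).

Lemma lookup_weight_table (t a b : seq bool) :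
  size t = 4%N -> size a = 6%N -> size b = 6%N ->
  lookup weight_table t a b = flag_weight t a b.
Proof. by move=> t4 a6 b6; rewrite /lookup !btree_get_tabulate. Qed.

Definition table_invariant (w : table) : bool :=
  all (fun p =>
    let links := [seq (a, subpattern 2 4 p a) | a <- bits 6] in
    all (fun t =>
      let wt := lookup w t in let wpt := lookup w (subpattern 3 4 p t) in
      all (fun a =>
        let wta := wt a.1 in let wpta := wpt a.2 in
        all (fun b => Z.eqb (wta b.1) (wpta b.2)) links) links)
      (bits 4))
    (permutations (iota 0 4)).

Lemma weight_table_invariant : table_invariant weight_table.
Proof. by vm_compute. Qed.

Lemma flag_weight_subpattern (p : seq nat) (t a b : seq bool) :
  perm_eq p (iota 0 4) -> size t = 4%N -> size a = 6%N -> size b = 6%N ->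
  flag_weight (subpattern 3 4 p t) (subpattern 2 4 p a) (subpattern 2 4 p b) =
    flag_weight t a b.
Proof.
rewrite -mem_permutations => p_iota t4 a6 b6.
have /allP/(_ p p_iota)/allP := weight_table_invariant.
have in_links c : size c = 6%N ->
    (c, subpattern 2 4 p c) \in [seq (c, subpattern 2 4 p c) | c <- bits 6].
  by move=> c6; apply: map_f; rewrite mem_bits c6.
move/(_ t); rewrite mem_bits t4 => /(_ isT)/allP/(_ _ (in_links a a6))/allP.
move/(_ _ (in_links b b6))/Z.eqb_eq => /=.
have p_size : size p = 4%N.
  by move: p_iota; rewrite mem_permutations => /perm_size.
by rewrite !lookup_weight_table ?size_subpattern ?p_size // => ->.
Qed.

Definition flag_code (T : Type) : Type := (seq T * seq T * seq T)%type.

Definition flag (V T : Type) (e : seq V -> T) (d f : V) (r : seq V) :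
    flag_code T :=
  (pattern 3 e r, link e d r, link e f r).

Definition flag_positions : seq (flag_code nat) :=
  [seq let d := nth 0 p 0 in let f := nth 0 p 1 in
       flag (ksubseq_index 3 6) d f (rem f (rem d (iota 0 6)))
   | p <- ksubseqs 2 (iota 0 6)]%N.

Definition table_weight (w : table) (s : seq bool) (q : flag_code nat) : Z :=
  let read p := [seq nth false s i | i <- p] in
  lookup w (read q.1.1) (read q.1.2) (read q.2).

Definition total_weight (w : table) (flags : seq (flag_code nat))
    (s : seq bool) : Z :=
  foldr (fun q z => table_weight w s q + z)%BZ 0%BZ flags.

Definition binary_value (s : seq bool) : N :=
  foldr (fun (b : bool) n => if b then N.succ_double n else N.double n) 0%num s.

Definition minimal_under (rs : seq (seq bool -> seq bool)) (s : seq bool) :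
    bool :=
  all (fun r => N.leb (binary_value s) (binary_value (r s))) rs.

Definition relabellings5 : seq (seq bool -> seq bool) :=
  [seq subpattern 3 5 p | p <- permutations (iota 0 5)].

Definition total_weights_checked (w : table)
    (rs : seq (seq bool -> seq bool)) (flags : seq (flag_code nat)) : bool :=
  all (fun s =>
    all (fun l => Z.leb (total_weight w flags (l ++ s)) 0) (bits 10))
    [seq s <- bits 10 | minimal_under rs s].

Lemma weight_table_checked :
  total_weights_checked weight_table relabellings5 flag_positions.
Proof. by vm_compute. Qed.

(** * The upper bound *)

Section SixVertices.

Variables (V : eqType) (e : seq V -> bool).
Hypothesis e_perm : perm_invariant e.

Definition rooted_weight (d f : V) (r : seq V) : Z :=
  flag_weight (pattern 3 e r) (link e d r) (link e f r).

Lemma rooted_weight_perm (d f : V) (r s : seq V) :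
  size r = 4%N -> perm_eq r s -> rooted_weight d f r = rooted_weight d f s.
Proof.
move=> r4 rs; have s4 : size s = 4%N by rewrite -(perm_size rs).
have [p p_iota ->] := perm_iotaP d rs; rewrite s4 in p_iota.
have p_uniq : uniq p by rewrite (perm_uniq p_iota) iota_uniq.
have p_sub : {subset p <= iota 0 (size s)}.
  by move=> i; rewrite s4 (perm_mem p_iota).
have link_sub c : link e c [seq nth d s i | i <- p] =
    subpattern 2 4 p (link e c s).
  by rewrite -s4; apply: pattern_subpattern => //; apply: perm_invariant_cons.
rewrite /rooted_weight !link_sub pattern_subpattern // s4.
by rewrite flag_weight_subpattern ?size_pattern ?s4.
Qed.

Lemma link_nth_pattern (x0 : V) (s : seq V) (d : nat) (r : seq nat) :
  uniq (d :: r) -> {subset d :: r <= iota 0 (size s)} ->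
  link e (nth x0 s d) [seq nth x0 s i | i <- r] =
    [seq nth false (pattern 3 e s) i
      | i <- link (ksubseq_index 3 (size s)) d r].
Proof.
move=> /= /andP[d_notin_r r_uniq] dr_sub.
rewrite /link pattern_map -pattern_comp; apply: eq_in_pattern => t t2 t_r.
rewrite (nth_pattern x0 e_perm) //=; last by rewrite t2.
  rewrite (subseq_uniq t_r) // andbT.
  by apply: contra d_notin_r; apply: mem_subseq.
move=> i; rewrite inE => /predU1P[->|it]; apply: dr_sub.
  exact: mem_head.
by rewrite inE (mem_subseq t_r it) orbT.
Qed.

Lemma rooted_weight_nth (x0 : V) (s : seq V) (d f : nat) (r : seq nat) :
  size s = 6%N -> perm_eq [:: d, f & r] (iota 0 6) ->
  rooted_weight (nth x0 s d) (nth x0 s f) [seq nth x0 s i | i <- r] =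
    table_weight weight_table (pattern 3 e s) (flag (ksubseq_index 3 6) d f r).
Proof.
move=> s6 dfr; have := perm_uniq dfr; rewrite iota_uniq /= inE negb_or.
case/and3P=> /andP[_ d_notin_r] f_notin_r r_uniq.
have sub (u : seq nat) : {subset u <= [:: d, f & r]} ->
    {subset u <= iota 0 (size s)}.
  by move=> u_sub i /u_sub; rewrite s6 (perm_mem dfr).
have [r4] : (size r).+2 = 6%N := perm_size dfr.
rewrite /rooted_weight !link_nth_pattern ?pattern_subpattern //=
  ?d_notin_r ?f_notin_r //.
- by rewrite s6 -lookup_weight_table ?size_map ?size_ksubseqs ?r4.
- by apply: sub => i ir; rewrite !inE ir !orbT.
- by apply: sub => i; rewrite !inE => ->; rewrite orbT.
- by apply: sub => i; rewrite !inE => /predU1P[->|->]; rewrite ?eqxx ?orbT.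
Qed.

Lemma pair_sum_rooted_weight (x0 : V) (s : seq V) : size s = 6%N ->
  pair_sum rooted_weight s =
    total_weight weight_table flag_positions (pattern 3 e s) *+ 2.
Proof.
move=> s6; pose x := nth x0 s.
pose w i j := rooted_weight (x i) (x j) (map x (rem j (rem i (iota 0 6)))).
have wC i j : w i j = w j i by rewrite /w remC /rooted_weight flag_weightC.
rewrite -[in LHS](take_size s) s6 -(map_nth_iota0 x0) ?s6 //.
rewrite (pair_sum_map rooted_weight_perm) // /pair_sum.
rewrite (sum_rem_ksubseqs 0 _ wC); congr (_ *+ 2).
have -> : total_weight weight_table flag_positions (pattern 3 e s) =
    \sum_(q <- flag_positions) table_weight weight_table (pattern 3 e s) q.
  by rewrite unlock.
rewrite big_map; apply: eq_big_seq => p; rewrite mem_ksubseqs => /andP[].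
case: p => [|d [|f [|? ?]]] // _ df_sub.
have /and3P[d_neq_f _ _] := subseq_uniq df_sub (iota_uniq 0 6).
apply: (rooted_weight_nth x0 (d := d) (f := f)) => //.
rewrite perm_sym perm_to_rem2 ?(mem_subseq df_sub) ?mem_head //.
rewrite rem_mem ?(mem_subseq df_sub) ?inE ?eqxx ?orbT //.
by apply: contraNneq d_neq_f => ->; rewrite inE.
Qed.

Lemma exists_minimal_pattern (x0 : V) (s : seq V) : size s = 5%N ->
  exists2 t, perm_eq t s & minimal_under relabellings5 (pattern 3 e t).
Proof.
move=> s5; pose value t := N.to_nat (binary_value (pattern 3 e t)).
have [] := @ex_minnP (fun n => n \in [seq value t | t <- permutations s]).
  by exists (value s); rewrite map_f // mem_permutations.
move=> n /mapP[t]; rewrite mem_permutations => ts -> value_min.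
exists t => //; apply/allP => _ /mapP[p + ->].
rewrite mem_permutations => p_iota.
have t5 : size t = 5%N by rewrite (perm_size ts).
pose u := [seq nth x0 t i | i <- p].
have ut : perm_eq u t by apply/(perm_iotaP x0); exists p; rewrite ?t5.
have u_sub : pattern 3 e u = subpattern 3 5 p (pattern 3 e t).
  rewrite -t5; apply: pattern_subpattern => // [|i].
    by rewrite (perm_uniq p_iota) iota_uniq.
  by rewrite t5 (perm_mem p_iota).
have /value_min : value u \in [seq value t | t <- permutations s].
  by rewrite map_f // mem_permutations (perm_trans ut).
rewrite /value u_sub; move: (binary_value _) (binary_value _) => m n'; lia.
Qed.

Lemma pair_sum_rooted_weight_le0 (s : seq V) : size s = 6%N ->
  pair_sum rooted_weight s <= 0.
Proof.
case: s => [//|x0 s] [s5].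
have [t ts t_min] := exists_minimal_pattern x0 s5.
have t5 : size t = 5%N by rewrite (perm_size ts).
have x0t6 : size (x0 :: t) = 6%N by rewrite /= t5.
rewrite -(pair_sum_perm rooted_weight_perm x0t6) ?perm_cons //.
rewrite (pair_sum_rooted_weight x0) // pmulrn_lle0 // pattern3_cons.
have /allP/(_ (pattern 3 e t)) := weight_table_checked.
rewrite mem_filter t_min mem_bits size_pattern t5 => /(_ isT)/allP.
move/(_ (link e x0 t)); rewrite mem_bits size_pattern t5 => /(_ isT).
by move: (total_weight _ _ _) => z; lia.
Qed.

End SixVertices.

Section DensityBound.

Variables (V : finType) (e : seq V -> bool).
Hypothesis e_perm : perm_invariant e.

Lemma three_edges_natr (s : seq bool) : three_edges s = (count id s == 3%N)%:R.
Proof. by rewrite /three_edges; case: eqP. Qed.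

Lemma sum_rooted_weight_ge (r : seq V) :
  993600%BZ * #|V|%:R *
    (27%:R * (\sum_d three_edges (pattern 3 e (d :: r))) - 20%:R * #|V|%:R)
  <= \sum_d \sum_f rooted_weight e d f r :> Z.
Proof.
pose c d := three_edges (pattern 3 e (d :: r)).
pose g d f :=
  diag_form (square_terms (pattern 3 e r)) (link e d r) (link e f r).
have -> : \sum_d \sum_f rooted_weight e d f r =
    \sum_d \sum_f g d f +
    \sum_d \sum_f 496800%BZ * (27%:R * (c d + c f) - 40%:R) :> Z.
  rewrite -big_split; apply: eq_bigr => d _; rewrite -big_split.
  by apply: eq_bigr => f _; rewrite /c !pattern3_cons.
have sum_const (a : Z) : \sum_(x : V) a = a * #|V|%:R.
  by rewrite sumr_const mulr_natr.
have -> : \sum_d \sum_f 496800%BZ * (27%:R * (c d + c f) - 40%:R) =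
    993600%BZ * #|V|%:R * (27%:R * (\sum_d c d) - 20%:R * #|V|%:R) :> Z.
  under eq_bigr => d _ do
    rewrite -mulr_sumr sumrB -mulr_sumr big_split /= !sum_const.
  rewrite -mulr_sumr sumrB -mulr_sumr big_split /= !sum_const -mulr_suml.
  rewrite (_ : 993600%BZ = 496800%BZ * 2%:R) //.
  move: (\sum_d c d) 496800%BZ => S a; ring.
rewrite lerDr; exact: (diag_form_sum_ge0 _ (square_terms_ge0 _)).
Qed.

Lemma card_three_edge_tuples_le :
  (27 * #|[set x : 5.-tuple V | edge_count e x == 3]| <= 20 * #|V| ^ 5)%N.
Proof.
have [V0|V_gt0] := posnP #|V|.
  by rewrite eq_card0 // => x; have := fintype0 (tnth x ord0) V0.
have : \sum_(r : 4.-tuple V) \sum_d \sum_f rooted_weight e d f r <= 0 :> Z.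
  have : \sum_(x : 6.-tuple V) pair_sum (rooted_weight e) x <= 0.
    by apply: sumr_le0 => x _; rewrite pair_sum_rooted_weight_le0 ?size_tuple.
  rewrite sum_tuple_pair_sum ?pmulrn_lle0 //; exact: rooted_weight_perm.
move/(le_trans (ler_sum _ (fun r _ => sum_rooted_weight_ge (tval r)))).
rewrite -mulr_sumr pmulr_rle0; last by rewrite mulr_gt0 // ltr0n.
rewrite sumrB -mulr_sumr sumr_const card_tuple exchange_big.
rewrite -(big_tupleS _ _ (fun x => three_edges (pattern 3 e x))).
under eq_bigr => x _ do rewrite three_edges_natr.
rewrite -natr_sum -big_mkcond sum1dep_card.
by rewrite -mulrnAr -mulrnA -expnS subr_le0 -!natrM ler_nat.
Qed.

End DensityBound.

Section OrderedCounting.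

Variables (V : finType) (E : {set {set V}}).

Definition edge (t : seq V) : bool := [set v in t] \in E.

Lemma edge_perm_invariant : perm_invariant edge.
Proof.
move=> s t st; rewrite /edge; congr (_ \in E); apply/setP => v.
by rewrite !inE (perm_mem st).
Qed.

Lemma card_spanned_edges (s : seq V) : is_3graph E -> uniq s ->
  #|spanned_edges E [set v in s]| = edge_count edge s.
Proof.
move=> /forall_inP E3 s_uniq; rewrite /edge_count count_map.
rewrite -(count_map (fun t : seq V => [set v in t]) (mem E)).
rewrite (permP (perm_ksubseqs_sets 3 s_uniq)).
rewrite -sum1_count big_enum_cond -sum1_card.
apply: eq_bigl => A; rewrite !inE [RHS]andbC; apply: andb_id2l => /E3 ->.
by rewrite andbT.
Qed.

Lemma card_uniq_tuple_sets (k : nat) (P : {set {set V}}) :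
  (forall A, A \in P -> #|A| = k) ->
  #|[set x : k.-tuple V | uniq x & [set v in x] \in P]| = (#|P| * k`!)%N.
Proof.
move=> P_k; rewrite -sum1_card.
pose vertices (x : k.-tuple V) := [set v in x].
rewrite (partition_big vertices [in P]) /= => [|x]; last first.
  by rewrite inE => /andP[].
rewrite -sum_nat_const; apply: eq_bigr => A PA; have A_k := P_k A PA.
rewrite sum1dep_card -ffactnn.
have <- : #|[set x : k.-tuple V | all (mem A) x & uniq x]| = (k ^_ k)%N.
  by rewrite card_uniq_tuples -[in RHS]A_k A_k.
apply: eq_card => x; rewrite !inE /vertices.
case x_uniq: (uniq x) => /=; last by rewrite andbF.
rewrite andbT; apply/andP/allP => [[_ /eqP <-] v vx | xA].
  by rewrite /= inE.
have xE : [set v in x] = A.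
  apply/eqP; rewrite eqEcard A_k cardsE (card_uniqP x_uniq) size_tuple leqnn.
  by rewrite andbT; apply/fintype.subsetP => v; rewrite inE; apply: xA.
by rewrite xE.
Qed.

Lemma e_mk_ordered (m k : nat) : is_3graph E ->
  (e_mk m k E * m`!)%N =
    #|[set x : m.-tuple V | uniq x & edge_count edge x == k]|.
Proof.
move=> E3; rewrite -card_uniq_tuple_sets => [|A]; last first.
  by rewrite inE => /andP[/eqP].
apply: eq_card => x; rewrite !inE; apply: andb_id2l => x_uniq.
by rewrite card_spanned_edges // cardsE (card_uniqP x_uniq) size_tuple eqxx.
Qed.

Lemma e_mk_5_3_le : is_3graph E -> (27 * (e_mk 5 3 E * 5`!) <= 20 * #|V| ^ 5)%N.
Proof.
move=> E3; apply: leq_trans (card_three_edge_tuples_le edge_perm_invariant).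
rewrite e_mk_ordered // leq_mul2l subset_leq_card //.
by apply/fintype.subsetP => x; rewrite !inE => /andP[].
Qed.

End OrderedCounting.

(** * The lower bound *)

Lemma count_wordsS (C : eqType) (P : pred (seq C)) (m : nat) (cs : seq C) :
  count P (words m.+1 cs) =
    (\sum_(c <- cs) count (fun w => P (c :: w)) (words m cs))%N.
Proof.
rewrite count_flatten sumnE !big_map.
by apply: eq_bigr => c _; rewrite count_map.
Qed.

Lemma card_colour_words (V : finType) (C : eqType) (f : V -> C) (cs : seq C)
    (q : nat) : uniq cs ->
  (forall c, c \in cs -> q <= #|[set v | f v == c]|)%N ->
  forall (m : nat) (P : pred (seq C)),
  (q ^ m * count P (words m cs) <= #|[set x : m.-tuple V | P (map f x)]|)%N.
Proof.
move=> cs_uniq q_le; elim=> [|m IHm] P; rewrite -sum1dep_card big_mkcond.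
  by rewrite (big_tuple0 _ (fun x => P (map f x) : nat)) mul1n /= addn0.
rewrite (big_tupleS _ _ (fun x => P (map f x) : nat)) /=.
pose N c := count (fun w => P (c :: w)) (words m cs).
apply: leq_trans (_ : \sum_v q ^ m * N (f v) <= _)%N; last first.
  by apply: leq_sum => v _; rewrite -big_mkcond sum1dep_card IHm.
rewrite count_wordsS -big_distrr /= expnSr -mulnA leq_mul2l; apply/orP; right.
apply: leq_trans (_ : \sum_(c <- cs) \sum_(v | f v == c) N (f v) <= _)%N.
  rewrite big_distrr /= big_seq [X in (_ <= X)%N]big_seq leq_sum // => c c_in.
  rewrite (eq_bigr (fun=> N c)) => [|v /eqP -> //].
  by rewrite sum_nat_cond_const leq_mul2r q_le ?orbT.
rewrite (exchange_big_dep predT) //= leq_sum // => v _.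
rewrite big_const_seq iter_addn_0 -[leqRHS]muln1 leq_mul2l.
rewrite (eq_count (a2 := pred1 (f v))) => [|c]; last by rewrite /= eq_sym.
by rewrite count_uniq_mem // leq_b1 orbT.
Qed.

Lemma residue_class_ge (n d c : nat) : (c < d)%N ->
  (n %/ d <= #|[set i : 'I_n | i %% d == c]|)%N.
Proof.
move=> c_lt; have lt_n (i : 'I_(n %/ d)) : (i * d + c < n)%N.
  apply: leq_trans (leq_divM n d); apply: (@leq_trans (i.+1 * d)).
    by rewrite mulSnr ltn_add2l.
  by rewrite leq_mul2r ltn_ord orbT.
pose g (i : 'I_(n %/ d)) := Ordinal (lt_n i).
have g_inj : injective g.
  move=> i j [] /eqP; rewrite eqn_add2r eqn_mul2r.
  by case/orP=> [/eqP d0|/eqP /val_inj //]; rewrite d0 in c_lt.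
rewrite -[X in (X <= _)%N]card_ord -(card_imset _ g_inj) subset_leq_card //.
apply/fintype.subsetP => _ /imsetP[i _ ->]; rewrite inE /=.
by rewrite modnMDl modn_small.
Qed.

Definition mod3_edge (c : seq nat) : bool := (sumn c %% 3 == 1)%N.

Definition mod3_graph (n : nat) : {set {set 'I_n}} :=
  [set A : {set 'I_n} | (#|A| == 3) && ((\sum_(i in A) i) %% 3 == 1)%N].

Lemma mod3_graph_3graph (n : nat) : is_3graph (mod3_graph n).
Proof. by apply/forall_inP => A; rewrite inE => /andP[]. Qed.

Lemma sumn_map_modn (d : nat) (s : seq nat) :
  sumn [seq i %% d | i <- s]%N = sumn s %[mod d].
Proof. by elim: s => //= i s IHs; rewrite modnDml -modnDmr IHs modnDmr. Qed.

Lemma edge_mod3_graph (n : nat) (t : seq 'I_n) : size t = 3%N -> uniq t ->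
  edge (mod3_graph n) t = mod3_edge [seq (val i %% 3)%N | i <- t].
Proof.
move=> t3 t_uniq; rewrite /edge inE cardsE (card_uniqP t_uniq) t3 eqxx /=.
rewrite (eq_bigl [in t]) => [|i]; last by rewrite inE.
rewrite -big_uniq // -(big_map val xpredT id) -sumnE /mod3_edge.
by rewrite (map_comp (fun i => i %% 3)%N val) sumn_map_modn.
Qed.

Lemma edge_count_mod3_graph (n : nat) (s : seq 'I_n) : uniq s ->
  edge_count (edge (mod3_graph n)) s =
    edge_count mod3_edge [seq (val i %% 3)%N | i <- s].
Proof.
move=> s_uniq; rewrite /edge_count pattern_map; congr count.
apply: eq_in_pattern => t t3 t_s.
by rewrite edge_mod3_graph // (subseq_uniq t_s).
Qed.

Lemma count_mod3_words :
  count (fun w => edge_count mod3_edge w == 3%N) (words 5 (iota 0 3)) = 180%N.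
Proof. by vm_compute. Qed.

Lemma card_uniq_tuple_ord (m n : nat) :
  #|[set x : m.-tuple 'I_n | uniq x]| = n ^_ m.
Proof.
rewrite -[in RHS](card_ord n) -card_uniq_tuples; apply: eq_card => x.
by rewrite !inE andb_idl // => _; apply/allP.
Qed.

Lemma e_mk_mod3_graph_ge (n : nat) :
  (180 * (n %/ 3) ^ 5 + n ^_ 5 <= e_mk 5 3 (mod3_graph n) * 5`! + n ^ 5)%N.
Proof.
pose good := [set x : 5.-tuple 'I_n |
  edge_count mod3_edge [seq (val i %% 3)%N | i <- x] == 3%N].
have good_ge : (180 * (n %/ 3) ^ 5 <= #|good|)%N.
  rewrite mulnC -count_mod3_words.
  apply: (card_colour_words (iota_uniq 0 3) _ 5
    (fun w => edge_count mod3_edge w == 3%N)) => c.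
  by rewrite mem_iota => /residue_class_ge.
rewrite e_mk_ordered ?mod3_graph_3graph // -(card_uniq_tuple_ord 5).
set U := [set x : 5.-tuple 'I_n | uniq x].
have -> : #|[set x : 5.-tuple 'I_n |
    uniq x & edge_count (edge (mod3_graph n)) x == 3%N]| = #|good :&: U|.
  apply: eq_card => x; rewrite !inE [RHS]andbC; apply: andb_id2l => x_uniq.
  by rewrite edge_count_mod3_graph.
apply: leq_trans (leq_add good_ge (leqnn _)) _.
rewrite -cardsUI addnC leq_add2l.
by rewrite (leq_trans (max_card _)) // card_tuple card_ord.
Qed.

(** * Complements and the limit *)

Definition complement_3graph (V : finType) (E : {set {set V}}) :
    {set {set V}} :=
  [set A : {set V} | (#|A| == 3) && (A \notin E)].

Lemma complement_is_3graph (V : finType) (E : {set {set V}}) :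
  is_3graph (complement_3graph E).
Proof. by apply/forall_inP => A; rewrite inE => /andP[]. Qed.

Lemma card_spanned_complement (V : finType) (E : {set {set V}}) (S : {set V}) :
  is_3graph E ->
  (#|spanned_edges E S| + #|spanned_edges (complement_3graph E) S|)%N =
    'C(#|S|, 3).
Proof.
move=> /forall_inP E3.
rewrite -cards_draws -(cardsID E [set A : {set V} | A \subset S & #|A| == 3]).
congr (_ + _)%N; apply: eq_card => A; rewrite !inE.
  by case: (boolP (A \in E)) => [/E3 ->|]; rewrite ?andbF ?andbT.
by rewrite -andbA andbC -andbA.
Qed.

Lemma max_e_mk_complement (m k n : nat) : (k <= 'C(m, 3))%N ->
  max_e_mk m ('C(m, 3) - k) n = max_e_mk m k n.
Proof.
have le_max i j : (i + j)%N = 'C(m, 3) -> (max_e_mk m i n <= max_e_mk m j n)%N.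
  move=> ij; apply/bigmax_leqP => E E3.
  apply: leq_trans (leq_bigmax_cond _ (complement_is_3graph E)).
  apply/subset_leq_card/fintype.subsetP => S; rewrite !inE.
  case/andP=> /eqP Sm /eqP Si; rewrite Sm eqxx /= -(eqn_add2l i) ij -Si -Sm.
  by rewrite card_spanned_complement.
by move=> k_le; apply/eqP; rewrite eqn_leq !le_max ?subnK ?subnKC.
Qed.

Section Limits.

Variable R : realType.

Lemma cvg_const_div_idn (a : R) : (a / n%:R @[n --> \oo] --> (0 : R))%classic.
Proof.
rewrite -(mulr0 a); apply: cvgM; first exact: cvg_cst.
apply/gtr0_cvgV0; last exact: cvgr_idn.
by near=> n; rewrite ltr0n; near: n; exact: nbhs_infty_gt.
Unshelve. all: by end_near. Qed.

Lemma cvg_sub_const_div_idn (a b : R) :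
  (a - b / n%:R @[n --> \oo] --> a)%classic.
Proof.
have := cvgB (cvg_cst a) (cvg_const_div_idn b).
by rewrite subr0; apply.
Qed.

Lemma cvg_ffact_div_exp (k : nat) :
  ((n ^_ k)%:R / n%:R ^+ k @[n --> \oo] --> (1 : R))%classic.
Proof.
elim: k => [|k IHk].
  by under eq_cvg do rewrite ffactn0 expr0 divr1; exact: cvg_cst.
have subn_cvg : ((n - k)%:R / n%:R @[n --> \oo] --> (1 : R))%classic.
  apply: (cvg_trans _ (cvg_sub_const_div_idn k%:R)).
  apply: near_eq_cvg; near=> n.
  have n_gt0 : (0 < n)%N by near: n; exact: nbhs_infty_gt.
  rewrite natrB; last by near: n; exact: nbhs_infty_ge.
  by rewrite mulrBl divff // pnatr_eq0 -lt0n.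
under eq_cvg do rewrite ffactnSr natrM exprSr -mulf_div.
by have := cvgM IHk subn_cvg; rewrite mulr1; apply.
Unshelve. all: by end_near. Qed.

Lemma cvg_divn_div_idn (d : nat) : (0 < d)%N ->
  ((n %/ d)%:R / n%:R @[n --> \oo] --> (d%:R^-1 : R))%classic.
Proof.
move=> d_gt0; have d_pos : 0 < d%:R :> R by rewrite ltr0n.
apply: (squeeze_cvgr _ (cvg_sub_const_div_idn 1) (cvg_cst _)).
near=> n; have n_pos : 0 < n%:R :> R.
  by rewrite ltr0n; near: n; exact: nbhs_infty_gt.
rewrite ler_pdivlMr // ler_pdivrMr // mulrBl divfK ?gt_eqF //.
rewrite lerBlDr !(mulrC d%:R^-1) ler_pdivlMr // ler_pdivrMr //.
rewrite natr1 -!natrM !ler_nat leq_divM.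
by rewrite ltnW ?ltn_ceil.
Unshelve. all: by end_near. Qed.

Definition tuple_density (m k n : nat) : R :=
  (max_e_mk m k n * m`!)%:R / n%:R ^+ m.

Lemma ratio_mkE (m k n : nat) : (0 < n)%N ->
  ratio_mk R m k n = tuple_density m k n / ((n ^_ m)%:R / n%:R ^+ m).
Proof.
move=> n_gt0; rewrite /ratio_mk /tuple_density -bin_ffact !natrM.
rewrite invf_div mulrA divfK ?expf_neq0 ?pnatr_eq0 -?lt0n // -mulf_div.
by rewrite divff ?mulr1 // pnatr_eq0 -lt0n fact_gt0.
Qed.

Lemma tuple_density_5_3_le (n : nat) : (0 < n)%N ->
  tuple_density 5 3 n <= 20 / 27.
Proof.
move=> n_gt0; rewrite ler_pdivrMr ?exprn_gt0 ?ltr0n //.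
rewrite mulrAC ler_pdivlMr ?ltr0n // -natrX -!natrM ler_nat -mulnA.
rewrite -leq_divRL //; apply/bigmax_leqP => E E3.
by have := e_mk_5_3_le E3; rewrite card_ord mulnC -mulnA -leq_divRL.
Qed.

Lemma tuple_density_5_3_ge (n : nat) : (0 < n)%N ->
  180 * ((n %/ 3)%:R / n%:R) ^+ 5 + (n ^_ 5)%:R / n%:R ^+ 5 - 1 <=
    tuple_density 5 3 n.
Proof.
move=> n_gt0; have n5_gt0 : 0 < n%:R ^+ 5 :> R by rewrite exprn_gt0 ?ltr0n.
rewrite -(ler_pM2r n5_gt0) expr_div_n mulrBl mulrDl -mulrA !divfK ?gt_eqF //.
rewrite mul1r lerBlDr -!natrX -natrM -!natrD ler_nat.
apply: leq_trans (e_mk_mod3_graph_ge n) _; rewrite leq_add2r leq_mul2r /=.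
exact: leq_bigmax_cond (mod3_graph_3graph n).
Qed.

Lemma cvg_tuple_density_5_3 :
  (tuple_density 5 3 n @[n --> \oo] --> (20 / 27 : R))%classic.
Proof.
pose c n : R := (n ^_ 5)%:R / n%:R ^+ 5.
have c_cvg : (c n @[n --> \oo] --> (1 : R))%classic := cvg_ffact_div_exp 5.
have q5_cvg : (((n %/ 3)%:R / n%:R) ^+ 5 @[n --> \oo] -->
    (3^-1 ^+ 5 : R))%classic.
  apply: (@continuous_cvg _ _ _ _ _ _ (fun z : R => z ^+ 5)).
    exact: exprn_continuous.
  exact: cvg_divn_div_idn.
have lower_cvg : (180 * ((n %/ 3)%:R / n%:R) ^+ 5 + c n - 1 @[n --> \oo] -->
    (20 / 27 : R))%classic.
  rewrite (_ : 20 / 27 = 180 * 3^-1 ^+ 5 + 1 - 1); last by lra.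
  apply: cvgB; last exact: cvg_cst.
  by apply: cvgD => //; apply: cvgM => //; exact: cvg_cst.
apply: (squeeze_cvgr _ lower_cvg (cvg_cst _)); near=> n.
have n_gt0 : (0 < n)%N by near: n; exact: nbhs_infty_gt.
by rewrite tuple_density_5_3_le ?tuple_density_5_3_ge.
Unshelve. all: by end_near. Qed.

Lemma cvg_ratio_mk_5_3 : (ratio_mk R 5 3 @ \oo --> (20 / 27 : R))%classic.
Proof.
have quotient_cvg : (tuple_density 5 3 n / ((n ^_ 5)%:R / n%:R ^+ 5)
    @[n --> \oo] --> (20 / 27 : R))%classic.
  have := cvgM cvg_tuple_density_5_3
    (cvgV (oner_neq0 R) (cvg_ffact_div_exp 5)).
  by rewrite invr1 mulr1; apply.
apply: (cvg_trans _ quotient_cvg); apply: near_eq_cvg; near=> n.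
by rewrite ratio_mkE //; near: n; exact: nbhs_infty_gt.
Unshelve. all: by end_near. Qed.

End Limits.

(* limn is a total operator, so convergence of the two defining sequences is
   asserted alongside the values of their limits. *)
Theorem theorem2p30 (R : realType) :
  [/\ cvgn (ratio_mk R 5 3), cvgn (ratio_mk R 5 7),
      pi_mk R 5 3 = pi_mk R 5 7 & pi_mk R 5 7 = 20%:R / 27%:R].
Proof.
have ratio_57 : ratio_mk R 5 7 = ratio_mk R 5 3.
  by apply/funext => n; rewrite /ratio_mk (@max_e_mk_complement 5 3).
have lim_53 := @cvg_ratio_mk_5_3 R.
have cvg_53 : cvgn (ratio_mk R 5 3) by apply/cvg_ex; exists (20 / 27).
by rewrite /pi_mk ratio_57; split=> //; apply: cvg_lim.
Qed.
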